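(* Let $\phi_6:\mathbb{Z}_6\to\mathbb{R}_+$ be the weight function $\phi_6(0)=0$, $\phi_6(1)=\phi_6(5)=1$, $\phi_6(2)=\phi_6(4)=2$, $\phi_6(3)=1$. Then for all $f\in L_2^+(\mathbb{Z}_6,\mu_6)$, $$\int_{\mathbb{Z}_6} f^2\log f^2\,d\mu_6-\|f\|_2^2\log\|f\|_2^2\le 2\langle f,A_{\phi_6}f\rangle_{L_2(\mathbb{Z}_6,\mu_6)}.$$
   Context: $\mathbb{Z}_6=\{0,1,\dots,5\}$ is the cyclic group of order $6$ with normalized counting measure $\mu_6$ (each point has mass $1/6$). $L_2^+(\mathbb{Z}_6,\mu_6)$ is the set of nonnegative real-valued functions on $\mathbb{Z}_6$; $\|f\|_2^2=\frac16\sum_x|f(x)|^2$ and $\langle\cdot,\cdot\rangle_{L_2(\mathbb{Z}_6,\mu_6)}$ is the corresponding inner product. The convention $0\log0=0$ is used. With $\chi_k(x)=e^{2\pi i kx/6}$, the operator $A_{\phi_6}$ is $A_{\phi_6}\big(\sum_{k=0}^{5}a_k\chi_k\big)=\sum_{k=0}^{5}\phi_6(k)a_k\chi_k$. *)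

(* Defs.v *)
From HB Require Import structures.
From mathcomp Require Import all_boot all_order all_algebra.
From mathcomp Require Import all_classical all_reals all_analysis.
From mathcomp Require Import complex.
From mathcomp Require Import ring lra zify.

Set Implicit Arguments.
Unset Strict Implicit.
Unset Printing Implicit Defensive.

Import Order.TTheory GRing.Theory Num.Theory.
Local Open Scope ring_scope.
Local Open Scope complex_scope.

(* Integral against the normalized counting measure mu_6; it is used both for
   real-valued (K = R) and for complex-valued (K = R[i]) functions. *)
Definition mean6 (K : fieldType) (g : 'Z_6 -> K) : K := 6%:R^-1 * \sum_x g x.

Definition norm2_sq (R : realType) (f : 'Z_6 -> R) : R :=
  mean6 (fun x => `|f x| ^+ 2).

Definition inner (R : realType) (g h : 'Z_6 -> R[i]) : R[i] :=
  mean6 (fun x => g x * (h x)^*).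

Definition expi (R : realType) (t : R) : R[i] := cos t +i* sin t.

Definition chi (R : realType) (k x : 'Z_6) : R[i] :=
  expi (2 * pi * (k : nat)%:R * (x : nat)%:R / 6).

(* The coefficient a_k in g = \sum_k a_k chi_k. *)
Definition fourier_coef (R : realType) (g : 'Z_6 -> R[i]) (k : 'Z_6) : R[i] :=
  inner g (chi R k).

(* A_phi (\sum_k a_k chi_k) = \sum_k phi(k) a_k chi_k; see chi_expansion and
   fourier_mult_chi below. *)
Definition fourier_mult (R : realType) (phi : 'Z_6 -> R) (g : 'Z_6 -> R[i]) :
    'Z_6 -> R[i] :=
  fun x => \sum_k (phi k)%:C * fourier_coef g k * chi R k x.

Definition phi6 (R : realType) (k : 'Z_6) : R := [:: 0; 1; 2; 1; 2; 1]`_k.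

Definition toC (R : realType) (f : 'Z_6 -> R) : 'Z_6 -> R[i] :=
  fun x => (f x)%:C.

Section Fourier.
Variable R : realType.
Implicit Types (a g : 'Z_6 -> R[i]) (phi : 'Z_6 -> R) (j k x : 'Z_6).

Let expiD (s t : R) : expi (s + t) = expi s * expi t.
Proof.
rewrite /expi cosD sinD; apply/eqP; rewrite eq_complex /=.
by rewrite eqxx addrC eqxx.
Qed.

Let expi0 : expi (0 : R) = 1.
Proof. by rewrite /expi cos0 sin0. Qed.

Let expiM (t : R) n : expi (t * n%:R) = expi t ^+ n.
Proof.
elim: n => [|n IHn]; first by rewrite mulr0 expi0.
by rewrite -natr1 mulrDr mulr1 expiD IHn exprSr.
Qed.

Let expiN (t : R) : ((expi t)^*)%R = expi (- t).
Proof. by rewrite /expi cosN sinN. Qed.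

Let w : R[i] := expi (2 * pi / 6).

Let wN : w * w^* = 1.
Proof. by rewrite /w expiN -expiD subrr expi0. Qed.

Let w6 : w ^+ 6 = 1.
Proof.
rewrite -expiM (_ : _ * 6%:R = pi *+ 2); last by field.
by rewrite /expi cos2pi sin2pi.
Qed.

Let w_neq1 d : (0 < d < 6)%N -> w ^+ d != 1.
Proof.
move=> /andP[d0 d6]; rewrite -expiM; apply/negP => /eqP[+ _].
set t : R := pi * d%:R / 6.
rewrite (_ : _ * _ = t *+ 2); last by rewrite /t; field.
rewrite cos_mulr2n => ct.
have : 0 < sin t.
  have p0 := pi_gt0 R.
  have d0' : 0 < d%:R :> R by rewrite ltr0n.
  have d6' : d%:R < 6 :> R by rewrite ltr_nat.
  apply: sin_gt0_pi; apply/andP; split; rewrite /t; nra.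
by have := cos2Dsin2 t; nra.
Qed.

Let chiE k x : chi R k x = w ^+ (k * x).
Proof. by rewrite -expiM /chi natrM; congr expi; field. Qed.

Lemma chi_orthonormal j k : inner (chi R j) (chi R k) = (j == k)%:R.
Proof.
set z := w ^+ j * (w ^+ k)^*.
have wk n : w ^+ n * (w ^+ n)^* = 1 by rewrite rmorphXn -exprMn wN expr1n.
have -> : inner (chi R j) (chi R k) = 6%:R^-1 * \sum_(i < 6) z ^+ i.
  congr (_ * _); apply: eq_bigr => x _.
  by rewrite !chiE !exprM rmorphXn -exprMn.
have [ejk|njk] := eqVneq j k.
  rewrite /z ejk wk (eq_bigr (fun=> 1)) => [|i _]; last by rewrite expr1n.
  by rewrite sumr_const card_ord mulVf // pnatr_eq0.
have z1 : z != 1.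
  apply: contra_neq njk => z1.
  have {z1} ejk : w ^+ j = w ^+ k.
    by rewrite -[LHS]mulr1 -(wk k) mulrCA -/z z1 mulr1.
  have w0 n : w ^+ n != 0.
    by apply: contra_eq_neq (wk n) => ->; rewrite mul0r eq_sym oner_eq0.
  have ltw (a b : 'Z_6) : (a < b)%N -> w ^+ a != w ^+ b.
    move=> ab; rewrite -(subnKC (ltnW ab)) exprD -[X in X != _]mulr1.
    rewrite (inj_eq (mulfI (w0 _))) eq_sym w_neq1 //.
    by rewrite subn_gt0 ab (leq_ltn_trans (leq_subr _ _)) // ltn_ord.
  apply/val_inj; case: (ltngtP j k) => // /ltw; rewrite ejk eqxx //.
have z6 : z ^+ 6 = 1.
  by rewrite exprMn -rmorphXn -!exprM -!(mulnC 6) !exprM w6 !expr1n rmorph1 mulr1.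
have /eqP := subrX1 z 6.
rewrite z6 subrr eq_sym mulf_eq0 subr_eq0 (negbTE z1) /= => /eqP ->.
by rewrite mulr0.
Qed.

Lemma fourier_coef_sum a k :
  fourier_coef (fun x => \sum_j a j * chi R j x) k = a k.
Proof.
transitivity (\sum_j a j * inner (chi R j) (chi R k)).
  rewrite /fourier_coef /inner /mean6.
  under eq_bigr do rewrite mulr_suml.
  rewrite exchange_big mulr_sumr; apply: eq_bigr => j _.
  rewrite mulrCA; congr (_ * _); rewrite mulr_sumr; apply: eq_bigr => x _.
  by rewrite mulrA.
rewrite (bigD1 k) //= chi_orthonormal eqxx mulr1 big1 ?addr0 // => j jk.
by rewrite chi_orthonormal (negbTE jk) mulr0.
Qed.

Lemma fourier_mult_chi phi a x :
  fourier_mult phi (fun y => \sum_k a k * chi R k y) x =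
  \sum_k (phi k)%:C * a k * chi R k x.
Proof. by apply: eq_bigr => k _; rewrite fourier_coef_sum. Qed.

Lemma chi_expansion g x : g x = \sum_k fourier_coef g k * chi R k x.
Proof.
have chiC (j k : 'Z_6) : chi R j k = chi R k j by rewrite !chiE mulnC.
rewrite /fourier_coef /inner /mean6.
transitivity (\sum_y g y * inner (chi R x) (chi R y)).
  rewrite (bigD1 x) //= chi_orthonormal eqxx mulr1 big1 ?addr0 // => y yx.
  by rewrite chi_orthonormal eq_sym (negbTE yx) mulr0.
under [RHS]eq_bigr do rewrite -mulrA mulr_suml.
rewrite -mulr_sumr exchange_big mulr_sumr; apply: eq_bigr => y _.
rewrite mulrCA; congr (_ * _); rewrite mulr_sumr; apply: eq_bigr => k _.
by rewrite (chiC x) (chiC y) mulrAC mulrA.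
Qed.

End Fourier.

(* Main.v *)
Require Import Defs.
From mathcomp Require Import all_boot all_order all_algebra.
From mathcomp Require Import all_classical all_reals all_analysis.
From mathcomp Require Import complex.
From mathcomp Require Import ring lra.

Import Order.TTheory GRing.Theory Num.Theory.
Import numFieldNormedType.Exports.
Local Open Scope ring_scope.
Local Open Scope complex_scope.

(** The multiplier phi6 k equals 3/2 + (-1)^k / 2 for k != 0, and shifting by 3
multiplies chi_k by (-1)^k, so the energy involves only the mean of f and the
three pairs {x, x + 3}.
Let s_i >= |d_i| be the half-sum and the half-difference of f on the i-th pair;
the right-hand side is twice the mean of the d_i^2 plus four times the variance
of the s_i ([inner_fourier_mult_phi6]), and the claim becomes an inequality
between six nonnegative numbers ([six_sqln_le]).

It has little room near the constants: if the mean of the s_i is 1, both sides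
agree to second order in every direction d, and to fourth order when a single
pair is unbalanced and the s_i are the best ones for that d. So each estimate
has to be exact to that order. Write z_i = (d_i / s_i)^2, which lies in [0, 1].
 - On a pair the mean of f^2 log f^2 is at most
   s^2 (2 (1 + z) log s + 3 z - z^2 / 6), from a fifth order Taylor bound whose
   odd terms cancel ([pair_sqln_le]).
 - The entropy is the minimum over c > 0 of the mean of
   f^2 log (f^2 / c) - f^2 + c. The choice c = s_1, the largest half-sum, keeps
   the fourth order equality and makes the pairs independent of one another.
 - In the two other pairs log can be replaced by a polynomial
   ([dominated_pair_le]); the resulting sum is largest when these two pairs have
   equal half-sums ([balance_dominated_pairs]).
 - What remains depends on x = s_1 - 1, on log (1 + x) and on z_1. Optimised over
   z_1 it is - x^3 / 2 + O(x^4), and Pade bounds for the logarithm show that it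
   is nonpositive for all x in [0, 2] ([dominating_pair_le]). *)

(** * Bounds for the logarithm *)

Section LogBounds.
Context {R : realType}.
Implicit Types (x y g : R).

(** Mean value theorem: it is enough that G' - F' has the sign of c - 1 at the
points c between 1 and x. *)
Lemma le_of_derive (F G dF dG : R -> R) x : 0 < x ->
  (forall c : R, 0 < c -> is_derive c (1:R) F (dF c)) ->
  (forall c : R, 0 < c -> is_derive c (1:R) G (dG c)) ->
  F 1 = G 1 ->
  (forall c : R, 0 < c -> 0 <= (c - 1) * (x - 1) ->
     0 <= (dG c - dF c) * (x - 1)) ->
  F x <= G x.
Proof.
move=> x0 dFP dGP FG1 sgn.
pose D : R -> R := G - F.
have dD (c : R) : 0 < c -> is_derive c (1:R) D (dG c - dF c).
  by move=> c0; have ? := dFP c c0; have ? := dGP c c0; apply: is_deriveB.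
have cD (a b : R) : 0 < a -> {within `[a, b], continuous D}%classic.
  move=> a0; apply: derivable_within_continuous => c.
  rewrite in_itv /= => /andP[ac _].
  by have [] := dD c (lt_le_trans a0 ac).
have D1 : D 1 = 0 by rewrite /D !fctE FG1 subrr.
suff : 0 <= D x by rewrite /D !fctE subr_ge0.
have [x1|x1|->] := ltrgtP x 1; last by rewrite D1.
- have [c|c] := @MVT _ D (fun c => dG c - dF c) x 1 x1 _ (cD x 1 x0).
    by rewrite in_itv /= => /andP[xc _]; exact: dD (lt_trans x0 xc).
  rewrite in_itv /= D1 => /andP[xc c1] E.
  have := sgn c (lt_trans x0 xc); nra.
- have [c|c] := @MVT _ D (fun c => dG c - dF c) 1 x x1 _ (cD 1 x ltr01).
    by rewrite in_itv /= => /andP[xc _]; exact: dD (lt_trans ltr01 xc).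
  rewrite in_itv /= D1 => /andP[c1 xc] E.
  have := sgn c (lt_trans ltr01 c1); nra.
Qed.

(** The derivatives differ by g^2 / ((1 + g) (2 + g)^2). *)
Lemma ln_ge_pade g : 0 <= g -> 2 * g / (2 + g) <= ln (1 + g).
Proof.
move=> g0.
(* partial fractions in y = 1 + g *)
pose F y : R := 2 - 4 * (1 + y)^-1.
have -> : 2 * g / (2 + g) = F (1 + g) by rewrite /F; field; lra.
apply: (@le_of_derive F (@ln R) (fun c => 4 * (1 + c) ^- 2) (fun c => c^-1)).
- lra.
- move=> c c0; rewrite /F.
  have h : 1 + c != 0 by lra.
  apply: is_derive_eq.
  by rewrite /GRing.scale /=; field; lra.
- by rewrite /F ln1; field.
- move=> c c0 cg.
  have -> : c^-1 - 4 * (1 + c) ^- 2 = (c - 1) ^+ 2 * c^-1 * (1 + c) ^- 2.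
    by field; apply/andP; split; lra.
  rewrite (_ : 1 + g - 1 = g); last by ring.
  have := sqr_ge0 (c - 1); move: (_ ^+ 2) => q q0.
  rewrite !mulr_ge0 ?invr_ge0 ?exprn_ge0 //; lra.
Qed.

(** The derivatives differ by 4 g^3 / ((1 + g) (6 + 4 g)^2). *)
Lemma ln_le_pade g : 0 <= g -> ln (1 + g) <= g * (6 + g) / (6 + 4 * g).
Proof.
move=> g0.
pose G y : R := (4 * y + 14 - 54 * (1 + 2 * y)^-1) / 16.
have -> : g * (6 + g) / (6 + 4 * g) = G (1 + g) by rewrite /G; field; lra.
apply: (@le_of_derive (@ln R) G (fun c => c^-1)
  (fun c => (4 + 108 * (1 + 2 * c) ^- 2) / 16)).
- lra.
- move=> c c0; rewrite /G.
  have h : 1 + 2 * c != 0 by lra.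
  apply: is_derive_eq.
  by rewrite /GRing.scale /=; field; lra.
- by rewrite /G ln1; field.
- move=> c c0 cg.
  have -> : ((4 + 108 * (1 + 2 * c) ^- 2) / 16 - c^-1) * (1 + g - 1) =
      (c - 1) ^+ 2 * ((c - 1) * (1 + g - 1)) * c^-1 * (1 + 2 * c) ^- 2.
    by field; apply/andP; split; lra.
  have := sqr_ge0 (c - 1); move: (_ ^+ 2) (_ * (_ - 1)) cg => q p p0 q0.
  rewrite !mulr_ge0 ?invr_ge0 ?exprn_ge0 //; lra.
Qed.

Definition sqln x : R := x ^+ 2 * ln (x ^+ 2).
(** Taylor polynomials at 1 of sqln, in the increment g. *)
Definition sqln3 g : R := 2 * g + 3 * g ^+ 2 + 2 / 3 * g ^+ 3.
Definition sqln5 g : R := sqln3 g - g ^+ 4 / 6 + g ^+ 5 / 15.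

Lemma is_derive_laurent (a3 a2 a1 a0 b1 b2 c : R) : c != 0 ->
  is_derive c (1:R)
    (fun y => a3 * y ^+ 3 + a2 * y ^+ 2 + a1 * y + a0 + b1 * y^-1 + b2 * y^-1 ^+ 2)
    (3 * a3 * c ^+ 2 + 2 * a2 * c + a1 - b1 / c ^+ 2 - 2 * b2 / c ^+ 3).
Proof.
move=> c0.
have cV : is_derive c (1:R) (fun y : R => y^-1) (- c ^- 2).
  have := @is_deriveV _ id c 1 1 c0 (is_derive_id _ _).
  by rewrite /GRing.scale /= mulr1.
have p2 : is_derive c (1:R) (fun y : R => y ^+ 2) (2 * c).
  by apply: is_derive_eq; rewrite /GRing.scale /=; ring.
have p3 : is_derive c (1:R) (fun y : R => y ^+ 3) (3 * c ^+ 2).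
  by apply: is_derive_eq; rewrite /GRing.scale /=; ring.
have c2 : is_derive c (1:R) (fun y : R => y^-1 ^+ 2) (- 2 / c ^+ 3).
  by apply: is_derive_eq; rewrite /GRing.scale /=; field.
apply: is_derive_eq.
by rewrite /GRing.scale /=; field.
Qed.

(** Divided by 2 x^2 the claim bounds ln x by a Laurent polynomial whose
derivative exceeds 1 / x by (x - 1)^5 / (10 x^3), of the sign of x - 1. *)
Lemma sqln_le5 x : 0 <= x -> sqln x <= sqln5 (x - 1).
Proof.
rewrite /sqln le_eqVlt => /predU1P[<-|x0].
  by rewrite expr0n mul0r /sqln5 /sqln3; lra.
rewrite lnXn // -[ln x *+ 2]mulr_natl.
(* sqln5 (y - 1) / (2 y^2) *)
pose G y : R := 30^-1 * y ^+ 3 + (- 4^-1) * y ^+ 2 + 1 * y + (- 3^-1)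
  + (- 2^-1) * y^-1 + 20^-1 * y^-1 ^+ 2.
have : ln x <= G x.
  apply: (@le_of_derive (@ln R) G (fun c => c^-1)
    (fun c => c^-1 + (c - 1) ^+ 5 / (10 * c ^+ 3))).
  - exact: x0.
  - move=> c c0.
    have h := is_derive_laurent 30^-1 (- 4^-1) 1 (- 3^-1) (- 2^-1) 20^-1 c (lt0r_neq0 c0).
    by apply: is_derive_eq h _; field; lra.
  - by rewrite /G ln1; field.
  move=> c c0 cx; rewrite addrC addKr.
  have -> : (c - 1) ^+ 5 / (10 * c ^+ 3) * (x - 1) =
    (c - 1) ^+ 4 * ((c - 1) * (x - 1)) * (10 * c ^+ 3)^-1.
    by ring.
  have := @exprn_even_ge0 R 4 (c - 1) isT; move: (_ ^+ 4) (_ * (x - 1)) cx => q p p0 q0.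
  by rewrite !mulr_ge0 ?invr_ge0 ?mulr_ge0 ?exprn_ge0 // ltW.
have -> : sqln5 (x - 1) = x ^+ 2 * (2 * G x).
  by rewrite /sqln5 /sqln3 /G; field; lra.
by move=> h; rewrite ler_wpM2l ?exprn_ge0 ?ler_pM2l // ltW.
Qed.

(** As for [sqln_le5], with excess (x - 1)^3 / (3 x^3). *)
Lemma sqln_le3 x : 0 <= x -> sqln x <= sqln3 (x - 1).
Proof.
rewrite /sqln le_eqVlt => /predU1P[<-|x0].
  by rewrite expr0n mul0r /sqln3; lra.
rewrite lnXn // -[ln x *+ 2]mulr_natl.
(* sqln3 (y - 1) / (2 y^2) *)
pose G y : R := 0 * y ^+ 3 + 0 * y ^+ 2 + 3^-1 * y + 2^-1
  + (- 1) * y^-1 + 6^-1 * y^-1 ^+ 2.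
have : ln x <= G x.
  apply: (@le_of_derive (@ln R) G (fun c => c^-1)
    (fun c => c^-1 + (c - 1) ^+ 3 / (3 * c ^+ 3))).
  - exact: x0.
  - move=> c c0.
    have h := is_derive_laurent 0 0 3^-1 2^-1 (- 1) 6^-1 c (lt0r_neq0 c0).
    by apply: is_derive_eq h _; field; lra.
  - by rewrite /G ln1; field.
  move=> c c0 cx; rewrite addrC addKr.
  have -> : (c - 1) ^+ 3 / (3 * c ^+ 3) * (x - 1) =
    (c - 1) ^+ 2 * ((c - 1) * (x - 1)) * (3 * c ^+ 3)^-1.
    by ring.
  have := sqr_ge0 (c - 1); move: (_ ^+ 2) (_ * (x - 1)) cx => q p p0 q0.
  by rewrite !mulr_ge0 ?invr_ge0 ?mulr_ge0 ?exprn_ge0 // ltW.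
have -> : sqln3 (x - 1) = x ^+ 2 * (2 * G x).
  by rewrite /sqln3 /G; field; lra.
by move=> h; rewrite ler_wpM2l ?exprn_ge0 ?ler_pM2l // ltW.
Qed.
End LogBounds.

(** * Estimates on a pair *)

Section Pairs.
Context {R : realType}.
Implicit Types (a b s p u v x l z : R).

Lemma sqlnM c y : 0 < c -> 0 <= y ->
  sqln (c * y) = c ^+ 2 * (2 * y ^+ 2 * ln c + sqln y) :> R.
Proof.
move=> c0; rewrite le_eqVlt => /predU1P[<-|y0].
  by rewrite /sqln mulr0 expr0n /= !mul0r mulr0 mul0r addr0 mulr0.
rewrite /sqln exprMn lnM ?posrE ?exprn_gt0 // (lnXn _ c0) -[ln c *+ 2]mulr_natl.
by ring.
Qed.

(** With a = s (1 + r) and b = s (1 - r) the odd powers of r in [sqln_le5] cancel;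
keeping - z^2 / 6, where z = r^2, makes the bound exact to fourth order in r. *)
Lemma pair_sqln_le a b : 0 <= a -> 0 <= b ->
  exists z, [/\ 0 <= z <= 1, ((a - b) / 2) ^+ 2 = z * ((a + b) / 2) ^+ 2 &
    (sqln a + sqln b) / 2 <=
    ((a + b) / 2) ^+ 2 * (2 * (1 + z) * ln ((a + b) / 2) + 3 * z - z ^+ 2 / 6)].
Proof.
move=> a0 b0; set s := (a + b) / 2.
have : 0 <= s by rewrite /s; lra.
rewrite le_eqVlt => /predU1P[s0|s0].
  have [a00 b00] : a = 0 /\ b = 0 by rewrite /s in s0; split; lra.
  exists 0; rewrite -s0 a00 b00 /sqln expr0n /= !mul0r subrr !mul0r expr0n.
  by split; rewrite ?addr0 ?mul0r ?lexx ?ler01.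
pose r := (a - b) / 2 / s.
have rs : r * s = (a - b) / 2 by rewrite /r divfK // gt_eqF.
have aE : a = s * (1 + r) by rewrite mulrDr mulr1 [s * r]mulrC rs /s; field.
have bE : b = s * (1 - r) by rewrite mulrBr mulr1 [s * r]mulrC rs /s; field.
have r1 : 0 <= 1 + r by rewrite -(pmulr_rge0 _ s0) -aE.
have r2 : 0 <= 1 - r by rewrite -(pmulr_rge0 _ s0) -bE.
exists (r ^+ 2); split.
- by rewrite sqr_ge0 /=; nra.
- by rewrite -rs exprMn.
rewrite {1}aE {1}bE !sqlnM //.
have := sqln_le5 _ r1; have := sqln_le5 _ r2; rewrite /sqln5 /sqln3.
set A := sqln _; set B := sqln _ => hB hA.
rewrite -mulrDr -mulrA ler_wpM2l ?sqr_ge0 //.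
have {hA hB} : A + B <= 6 * r ^+ 2 - r ^+ 4 / 3 by lra.
by lra.
Qed.

(** A pair whose half-sum s > 0 is at most the largest one, p, has
2 ln s - ln p <= ln s <= s - 1: its imbalance z helps only if s > 1, and then by
at most the maximum 3/2 (s - 1)^2 of z (s - 1) - z^2 / 6. *)
Lemma dominated_pair_le s p z : 0 <= s <= p -> 1 <= p -> 0 <= z <= 1 ->
  s ^+ 2 * ((1 + z) * (2 * ln s - ln p) - z ^+ 2 / 6 - 5) <=
  sqln3 (s - 1) - (ln p + 5) * s ^+ 2
    + 3 / 2 * (s * Num.max (s - 1) 0) ^+ 2.
Proof.
move=> /andP[s0 sp] p1 /andP[z0 z1].
have h3 := sqln_le3 _ s0.
have : 0 <= s by []; rewrite le_eqVlt => /predU1P[s00|sgt0].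
  rewrite -s00 expr0n /= !mul0r mulr0 expr0n /= /sqln3; lra.
have lsp : ln s <= ln p by rewrite ler_ln ?posrE //; lra.
have ls1 : ln s <= s - 1.
  by have := @le_ln1Dx R (s - 1); rewrite (addrC 1) subrK; apply; lra.
have zL : z * (2 * ln s - ln p) - z ^+ 2 / 6 <= 3 / 2 * Num.max (s - 1) 0 ^+ 2.
  have : z * (2 * ln s - ln p) <= z * (s - 1) by rewrite ler_wpM2l //; lra.
  case: (leP (s - 1) 0) => s1; first by nra.
  by have := sqr_ge0 (z - 3 * (s - 1)); nra.
have {}zL := ler_wpM2l (sqr_ge0 s) zL.
move: h3; rewrite /sqln lnXn // -[ln s *+ 2]mulr_natl.
by move: zL; rewrite exprMn; nra.
Qed.

(** For u = - x / 2 + h and v = - x / 2 - h the cubic part loses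
2 (2 + x + l) h^2. At most one of u, v is positive, say u; then h >= 3/2 u since
u <= x, and the loss pays for 3/2 ((1 + u) u)^2. *)
Lemma balance_dominated_pairs x u v l : 0 <= x -> 0 <= l -> u + v = - x ->
  - 1 <= u -> - 1 <= v -> u <= x -> v <= x ->
  sqln3 u + sqln3 v - (l + 5) * ((1 + u) ^+ 2 + (1 + v) ^+ 2)
    + 3 / 2 * (((1 + u) * Num.max u 0) ^+ 2 + ((1 + v) * Num.max v 0) ^+ 2)
  <= 2 * (sqln3 (- x / 2) - (l + 5) * (1 - x / 2) ^+ 2).
Proof.
move=> x0 l0; wlog uv : u v / v <= u => [H|].
  case: (leP v u) => [|/ltW] vu uvx u1 v1 ux vx; first exact: H.
  by have := H _ _ vu; rewrite addrC => /(_ uvx v1 u1 vx ux); lra.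
move=> uvx u1 v1 ux vx.
have v0 : v <= 0 by lra.
pose h := u + x / 2.
have E : sqln3 u + sqln3 v - (l + 5) * ((1 + u) ^+ 2 + (1 + v) ^+ 2) =
    2 * (sqln3 (- x / 2) - (l + 5) * (1 - x / 2) ^+ 2) - 2 * (2 + x + l) * h ^+ 2.
  have -> : v = - x - u by lra.
  by rewrite /h /sqln3; field.
rewrite {}E [Num.max v 0]max_r // mulr0 expr0n /= addr0.
have -> : forall A B C : R, A - B + C <= A = (C <= B) by move=> A B C; lra.
case: (leP u 0) => u0; first by rewrite mulr0 expr0n /= mulr0 mulr_ge0 ?sqr_ge0 //; lra.
have hu : (3 / 2 * u) ^+ 2 <= h ^+ 2 by rewrite ler_pXn2r ?nnegrE //; rewrite /h; lra.
have u32 : (1 + u) ^+ 2 <= 3 / 2 * (2 + x) by nra.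
rewrite exprMn; nra.
Qed.

(** Here 1 + x and l stand for the largest half-sum and its logarithm. In z the
maximum of z l - z^2 / 6 is at z = 3 l, which leaves [0, 1] when l > 1/3. Since
2 x / (2 + x) = 1/3 at x = 2/5, two regimes suffice: the free maximum
3/2 l^2 for x <= 2/5, the value at z = 1 for x > 2/5. *)
Lemma dominating_pair_le x l z : 0 <= x <= 2 -> 0 <= z <= 1 ->
  2 * x / (2 + x) <= l -> l <= x * (6 + x) / (6 + 4 * x) ->
  (1 + x) ^+ 2 * ((1 + z) * l - z ^+ 2 / 6 - 5)
  + 2 * (sqln3 (- x / 2) - (l + 5) * (1 - x / 2) ^+ 2) + 12 + 3 * (1 + x) <= 0.
Proof.
move=> /andP[x0 x2] /andP[z0 z1]; rewrite ler_pdivrMr; last by lra.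
rewrite ler_pdivlMr; last by lra.
move=> lo hi.
case: (leP x (2 / 5)) => x25.
  have zl : z * l - z ^+ 2 / 6 <= 3 / 2 * l ^+ 2.
    by have := sqr_ge0 (z - 3 * l); nra.
  have := ler_wpM2l (sqr_ge0 (1 + x)) zl.
  suff : (- 1 + 4 * x + x ^+ 2 / 2) * l + 3 / 2 * ((1 + x) ^+ 2 * l ^+ 2)
     + x - 6 * x ^+ 2 - x ^+ 3 / 6 <= 0 by rewrite /sqln3; nra.
  have l0 : 0 <= l by nra.
  (* Put the bounds for l^2 and k l into the left-hand side and clear the
     denominators: a multiple of x^3 remains, the lower orders cancel. *)
  set k := - 1 + 4 * x + x ^+ 2 / 2.
  have d0 : 0 < 6 + 4 * x by lra.
  have l2 : l ^+ 2 * (6 + 4 * x) ^+ 2 <= (x * (6 + x)) ^+ 2.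
    by rewrite -exprMn ler_pXn2r // nnegrE; nra.
  have {}l2 := ler_wpM2l (sqr_ge0 (1 + x)) l2.
  have x3 : 0 <= x ^+ 3 by rewrite exprn_ge0.
  (* the sign of k decides which bound for l is the useful one *)
  case: (leP 0 k) => k0.
  - rewrite -(pmulr_lle0 _ (exprn_gt0 2 d0)).
    have kl : k * (l * (6 + 4 * x)) <= k * (x * (6 + x)) by rewrite ler_wpM2l.
    have {}kl := ler_wpM2r (ltW d0) kl.
    have : x ^+ 3 * (- 18 + 37 / 2 * x + 61 / 3 * x ^+ 2 + 3 / 2 * x ^+ 3) <= 0.
      by rewrite mulr_ge0_le0 //; nra.
    rewrite /k in kl *; nra.
  - have d2 : 0 < (6 + 4 * x) ^+ 2 * (2 + x) by rewrite mulr_gt0 ?exprn_gt0 //; lra.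
    rewrite -(pmulr_lle0 _ d2).
    have kl : k * (l * (2 + x)) <= k * (2 * x) by rewrite ler_wnM2l // ltW.
    have {}kl := ler_wpM2r (ltW (exprn_gt0 2 d0)) kl.
    have d3 : 0 <= 2 + x by lra.
    have {}l2 := ler_wpM2r d3 l2.
    have : x ^+ 3 * (- 30 - x + 241 / 6 * x ^+ 2 + 64 / 3 * x ^+ 3 + 3 / 2 * x ^+ 4) <= 0.
      by rewrite mulr_ge0_le0 //; nra.
    rewrite /k in kl *; nra.
have l3 : 1 / 3 <= l by nra.
have zl : z * l - z ^+ 2 / 6 <= l - 1 / 6.
  have : 0 <= (1 - z) * (l - (1 + z) / 6) by rewrite mulr_ge0 //; lra.
  lra.
have := ler_wpM2l (sqr_ge0 (1 + x)) zl.
suff : (6 * x + 3 / 2 * x ^+ 2) * l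
   - 1 / 6 + 2 / 3 * x - 37 / 6 * x ^+ 2 - x ^+ 3 / 6 <= 0 by rewrite /sqln3; nra.
have d0 : 0 < 6 + 4 * x by lra.
rewrite -(pmulr_lle0 _ d0).
have k0 : 0 <= 6 * x + 3 / 2 * x ^+ 2 by nra.
have := ler_wpM2l k0 hi.
suff : - 1 + 10 / 3 * x + 5 / 3 * x ^+ 2 - 32 / 3 * x ^+ 3 + 5 / 6 * x ^+ 4 <= 0 by nra.
have [y y0 xE] : exists2 y, 0 <= y & x = y + 2 / 5 by exists (x - 2 / 5); lra.
have y2 : y <= 2 by lra.
have y3 : 0 <= y ^+ 3 by rewrite exprn_ge0.
rewrite xE; nra.
Qed.
End Pairs.

(** * The inequality for six numbers *)

Section SixPointInequality.
Context {R : realType}.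
Implicit Types (a b t m : R).

(** The half-sums have mean 1, hence s1 >= 1. Taking s1 as reference value in
the variational bound for the entropy turns the claim into a sum of one term
per pair, to which the three estimates above apply. *)
Lemma six_sqln_le_normalized a1 b1 a2 b2 a3 b3 t :
  0 <= a1 -> 0 <= b1 -> 0 <= a2 -> 0 <= b2 -> 0 <= a3 -> 0 <= b3 ->
  a1 + b1 + a2 + b2 + a3 + b3 = 6 ->
  a2 + b2 <= a1 + b1 -> a3 + b3 <= a1 + b1 ->
  t = (a1 ^+ 2 + b1 ^+ 2 + a2 ^+ 2 + b2 ^+ 2 + a3 ^+ 2 + b3 ^+ 2) / 6 ->
  (sqln a1 + sqln b1 + sqln a2 + sqln b2 + sqln a3 + sqln b3) / 6 - t * ln t
  <= 2 / 3 * (((a1 - b1) / 2) ^+ 2 + ((a2 - b2) / 2) ^+ 2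
              + ((a3 - b3) / 2) ^+ 2)
     + 4 / 3 * (((a1 + b1) / 2) ^+ 2 + ((a2 + b2) / 2) ^+ 2
                + ((a3 + b3) / 2) ^+ 2) - 4.
Proof.
move=> a10 b10 a20 b20 a30 b30 sum6 le21 le31 tE.
have [z1 [z1b d1 h1]] := pair_sqln_le _ _ a10 b10.
have [z2 [z2b d2 h2]] := pair_sqln_le _ _ a20 b20.
have [z3 [z3b d3 h3]] := pair_sqln_le _ _ a30 b30.
have sq a b : a ^+ 2 + b ^+ 2 = 2 * (((a + b) / 2) ^+ 2 + ((a - b) / 2) ^+ 2).
  by field.
have {}tE : 3 * t = (1 + z1) * ((a1 + b1) / 2) ^+ 2
  + (1 + z2) * ((a2 + b2) / 2) ^+ 2 + (1 + z3) * ((a3 + b3) / 2) ^+ 2.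
  have := sq a1 b1; have := sq a2 b2; have := sq a3 b3.
  by rewrite d1 d2 d3; lra.
rewrite d1 d2 d3.
have : (a1 + b1) / 2 + (a2 + b2) / 2 + (a3 + b3) / 2 = 3 by lra.
have : 0 <= (a2 + b2) / 2 <= (a1 + b1) / 2 by apply/andP; split; lra.
have : 0 <= (a3 + b3) / 2 <= (a1 + b1) / 2 by apply/andP; split; lra.
move: h1 h2 h3 tE {d1 d2 d3 sq le21 le31 sum6}.
move: ((a1 + b1) / 2) ((a2 + b2) / 2) ((a3 + b3) / 2) => s1 s2 s3.
move=> h1 h2 h3 tE s3b s2b s123.
have s11 : 1 <= s1 by lra.
have t0 : 0 < t by case/andP: z1b => ? ?; case/andP: z2b => ? ?; case/andP: z3b => ? ?; nra.
(* variational bound for the entropy, with reference value s1 instead of t *)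
have ht : - (t * ln t) <= - t * ln s1 - t + s1.
  have s10 : 0 < s1 by lra.
  have : ln (s1 / t) <= s1 / t - 1.
    have := @le_ln1Dx R (s1 / t - 1); rewrite (addrC 1) subrK; apply.
    by have := divr_gt0 s10 t0; lra.
  rewrite ln_div ?posrE // => /(ler_wpM2l (ltW t0)).
  by rewrite mulrBr [t * (s1 / t - 1)]mulrBr mulrCA divff ?gt_eqF //; lra.
have m2 := dominated_pair_le _ _ _ s2b s11 z2b.
have m3 := dominated_pair_le _ _ _ s3b s11 z3b.
have [x xE] : exists x, s1 = 1 + x by exists (s1 - 1); lra.
have x0 : 0 <= x by lra.
have x2 : x <= 2 by lra.
have lo := ln_ge_pade _ x0; have hi := ln_le_pade _ x0.
rewrite -xE in lo hi.
have l0 : 0 <= ln s1 by rewrite ln_ge0.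
have mm := @balance_dominated_pairs R x (s2 - 1) (s3 - 1) (ln s1) x0 l0.
have {}mm := mm ltac:(clear -s123 xE; lra) ltac:(clear -s2b; lra)
  ltac:(clear -s3b; lra) ltac:(clear -s2b xE; lra) ltac:(clear -s3b xE; lra).
rewrite ![1 + (_ - 1)]addrC !subrK in mm.
have x02 : 0 <= x <= 2 by rewrite x0.
have M := dominating_pair_le _ _ _ x02 z1b lo hi.
rewrite -xE in M.
have tl : 3 * (t * ln s1) = ((1 + z1) * s1 ^+ 2 + (1 + z2) * s2 ^+ 2 + (1 + z3) * s3 ^+ 2) * ln s1.
  by rewrite -tE; ring.
nra.
Qed.

(** Both sides are homogeneous of degree 2: the terms in ln m cancel. *)
Lemma six_sqln_le_scaled m a1 b1 a2 b2 a3 b3 t : 0 < m ->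
  0 <= a1 -> 0 <= b1 -> 0 <= a2 -> 0 <= b2 -> 0 <= a3 -> 0 <= b3 ->
  a1 + b1 + a2 + b2 + a3 + b3 = 6 ->
  a2 + b2 <= a1 + b1 -> a3 + b3 <= a1 + b1 ->
  t = ((m * a1) ^+ 2 + (m * b1) ^+ 2 + (m * a2) ^+ 2 + (m * b2) ^+ 2
       + (m * a3) ^+ 2 + (m * b3) ^+ 2) / 6 ->
  (sqln (m * a1) + sqln (m * b1) + sqln (m * a2) + sqln (m * b2)
   + sqln (m * a3) + sqln (m * b3)) / 6 - t * ln t
  <= 2 / 3 * (((m * a1 - m * b1) / 2) ^+ 2 + ((m * a2 - m * b2) / 2) ^+ 2
              + ((m * a3 - m * b3) / 2) ^+ 2)
     + 4 / 3 * (((m * a1 + m * b1) / 2) ^+ 2 + ((m * a2 + m * b2) / 2) ^+ 2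
                + ((m * a3 + m * b3) / 2) ^+ 2) - 4 * m ^+ 2.
Proof.
move=> m0 a10 b10 a20 b20 a30 b30 sum6 le21 le31.
pose T := (a1 ^+ 2 + b1 ^+ 2 + a2 ^+ 2 + b2 ^+ 2 + a3 ^+ 2 + b3 ^+ 2) / 6.
have T0 : 0 < T.
  have q a : 2 * a - 1 <= a ^+ 2 by have := sqr_ge0 (a - 1); lra.
  have := q a1; have := q b1; have := q a2; have := q b2; have := q a3.
  by have := q b3; rewrite /T; lra.
have -> : ((m * a1) ^+ 2 + (m * b1) ^+ 2 + (m * a2) ^+ 2 + (m * b2) ^+ 2
   + (m * a3) ^+ 2 + (m * b3) ^+ 2) / 6 = m ^+ 2 * T by rewrite /T; field.
move=> ->.
have := six_sqln_le_normalized a1 b1 a2 b2 a3 b3 T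
  a10 b10 a20 b20 a30 b30 sum6 le21 le31 erefl.
move=> /(ler_wpM2l (sqr_ge0 m)).
rewrite !sqlnM // lnM ?posrE ?exprn_gt0 //.
rewrite lnXn // -[ln m *+ 2]mulr_natl.
have shift (A B C D : R) : D - C = B - A -> A <= B -> C <= D by move=> *; lra.
by apply: shift; rewrite /T; field.
Qed.

Lemma six_sqln_le a1 b1 a2 b2 a3 b3 t :
  0 <= a1 -> 0 <= b1 -> 0 <= a2 -> 0 <= b2 -> 0 <= a3 -> 0 <= b3 ->
  t = (a1 ^+ 2 + b1 ^+ 2 + a2 ^+ 2 + b2 ^+ 2 + a3 ^+ 2 + b3 ^+ 2) / 6 ->
  (sqln a1 + sqln b1 + sqln a2 + sqln b2 + sqln a3 + sqln b3) / 6 - t * ln t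
  <= 2 / 3 * (((a1 - b1) / 2) ^+ 2 + ((a2 - b2) / 2) ^+ 2
              + ((a3 - b3) / 2) ^+ 2)
     + 4 / 3 * (((a1 + b1) / 2) ^+ 2 + ((a2 + b2) / 2) ^+ 2
                + ((a3 + b3) / 2) ^+ 2)
     - 4 * ((a1 + b1 + a2 + b2 + a3 + b3) / 6) ^+ 2.
Proof.
move=> a10 b10 a20 b20 a30 b30 tE.
set m := (a1 + b1 + a2 + b2 + a3 + b3) / 6.
have : 0 <= m by rewrite /m; lra.
rewrite le_eqVlt => /predU1P[m0|m0].
  have [A1 B1] : a1 = 0 /\ b1 = 0 by rewrite /m in m0; split; lra.
  have [A2 B2] : a2 = 0 /\ b2 = 0 by rewrite /m in m0; split; lra.
  have [A3 B3] : a3 = 0 /\ b3 = 0 by rewrite /m in m0; split; lra.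
  rewrite tE -m0 A1 B1 A2 B2 A3 B3 /sqln expr0n /= !mul0r !addr0 !mul0r subrr mul0r.
  by rewrite expr0n /=; lra.
have sc a : m * (a / m) = a by rewrite mulrC divfK ?gt_eqF.
have ge a : 0 <= a -> 0 <= a / m by move=> ?; rewrite divr_ge0 // ltW.
have sum6 : a1 / m + b1 / m + a2 / m + b2 / m + a3 / m + b3 / m = 6.
  apply: (mulfI (lt0r_neq0 m0)); rewrite !mulrDr !sc.
  by rewrite /m; field.
have le a b c d : a + b <= c + d -> a / m + b / m <= c / m + d / m.
  by move=> ?; rewrite -!mulrDl ler_pM2r ?invr_gt0.
have ge1 := ge _ a10; have ge2 := ge _ b10; have ge3 := ge _ a20.
have ge4 := ge _ b20; have ge5 := ge _ a30; have ge6 := ge _ b30.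
have H1 := six_sqln_le_scaled m (a1 / m) (b1 / m) (a2 / m) (b2 / m)
  (a3 / m) (b3 / m) t m0 ge1 ge2 ge3 ge4 ge5 ge6.
have H2 := six_sqln_le_scaled m (a2 / m) (b2 / m) (a3 / m) (b3 / m)
  (a1 / m) (b1 / m) t m0 ge3 ge4 ge5 ge6 ge1 ge2.
have H3 := six_sqln_le_scaled m (a3 / m) (b3 / m) (a1 / m) (b1 / m)
  (a2 / m) (b2 / m) t m0 ge5 ge6 ge1 ge2 ge3 ge4.
move: H1 H2 H3; rewrite !sc => H1 H2 H3.
have tE2 : t = (a2 ^+ 2 + b2 ^+ 2 + a3 ^+ 2 + b3 ^+ 2 + a1 ^+ 2 + b1 ^+ 2) / 6.
  by rewrite tE; field.
have tE3 : t = (a3 ^+ 2 + b3 ^+ 2 + a1 ^+ 2 + b1 ^+ 2 + a2 ^+ 2 + b2 ^+ 2) / 6.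
  by rewrite tE; field.
have sum62 : a2 / m + b2 / m + a3 / m + b3 / m + a1 / m + b1 / m = 6.
  by rewrite -sum6; ring.
have sum63 : a3 / m + b3 / m + a1 / m + b1 / m + a2 / m + b2 / m = 6.
  by rewrite -sum6; ring.
have [h12|/ltW h12] := leP (a2 + b2) (a1 + b1).
  have [h13|/ltW h13] := leP (a3 + b3) (a1 + b1).
    by have := H1 sum6 (le _ _ _ _ h12) (le _ _ _ _ h13) tE; rewrite -/m.
  have h := H3 sum63 (le _ _ _ _ h13) (le _ _ _ _ (le_trans h12 h13)) tE3.
  by lra.
have [h23|/ltW h23] := leP (a3 + b3) (a2 + b2).
  by have h := H2 sum62 (le _ _ _ _ h23) (le _ _ _ _ h12) tE2; lra.
have h := H3 sum63 (le _ _ _ _ (le_trans h12 h23)) (le _ _ _ _ h23) tE3.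
by lra.
Qed.
End SixPointInequality.

(** * The multiplier in terms of the shift by 3 *)

Section Multiplier.
Context {R : realType}.
Implicit Types (g : 'Z_6 -> R[i]) (f : 'Z_6 -> R) (k x y : 'Z_6).

Lemma chi_shift3 k x : chi R k (x + 3) = (-1) ^+ k * chi R k x.
Proof.
have expiD (s t : R) : expi (s + t) = expi s * expi t.
  rewrite /expi cosD sinD; apply/eqP; rewrite eq_complex /=.
  by rewrite eqxx addrC eqxx.
have expiM (t : R) n : expi (t * n%:R) = expi t ^+ n.
  elim: n => [|n IHn]; first by rewrite mulr0 /expi cos0 sin0.
  by rewrite -natr1 mulrDr mulr1 expiD IHn exprSr.
pose w : R[i] := expi (pi / 3).
have w3 : w ^+ 3 = -1.
  rewrite -expiM divfK ?pnatr_eq0 // /expi cospi sinpi.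
  by apply/eqP; rewrite eq_complex /= oppr0 !eqxx.
have chiE j y : chi R j y = w ^+ (j * y).
  by rewrite -expiM /chi natrM; congr expi; field.
rewrite !chiE mulnC exprM.
have -> : w ^+ ((x + 3) %% 6) = w ^+ (x + 3).
  by rewrite -[in RHS](expr_mod _ (n := 6)) // (exprM w 3 2) w3 sqrrN expr1n.
by rewrite -exprM mulnDl exprD mulrC exprM w3 mulnC.
Qed.

Lemma chi0l x : chi R 0 x = 1.
Proof. by rewrite /chi /expi mulr0 !mul0r cos0 sin0. Qed.

Lemma mean6_chi k : mean6 (chi R k) = (k == 0)%:R.
Proof.
rewrite -(chi_orthonormal R k 0); congr (_ * _); apply: eq_bigr => x _.
by rewrite chi0l rmorph1 mulr1.
Qed.

(** This form explains the next lemma: (-1)^k is the eigenvalue of the shift by 3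
and the indicator of 0 that of the mean. *)
Lemma phi6E k :
  (phi6 R k)%:C = 3 / 2 + 1 / 2 * (-1) ^+ k - 2 * (k == 0)%:R :> R[i].
Proof.
case: k; do 6?[case=> [lt6|]] => //; rewrite /phi6 /=.
all: by rewrite ?rmorph0 ?rmorph1 ?rmorph_nat; field.
Qed.

Lemma fourier_mult_phi6 g x :
  fourier_mult (@phi6 R) g x = 3 / 2 * g x + 1 / 2 * g (x + 3) - 2 * mean6 g.
Proof.
rewrite (chi_expansion g x) (chi_expansion g (x + 3)).
have -> : mean6 g = \sum_k fourier_coef g k * mean6 (chi R k).
  transitivity (mean6 (fun x => \sum_k fourier_coef g k * chi R k x)).
    by congr (_ * _); apply: eq_bigr => y _; exact: chi_expansion.
  rewrite /mean6 exchange_big mulr_sumr; apply: eq_bigr => k _.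
  by rewrite -mulr_sumr mulrCA.
rewrite !mulr_sumr -big_split -sumrB; apply: eq_bigr => k _ /=.
rewrite chi_shift3 mean6_chi phi6E.
have [->|k0] := eqVneq k 0; last by rewrite !mulr0; field.
by rewrite chi0l; field.
Qed.

Lemma inner_fourier_mult_phi6 f :
  inner (toC f) (fourier_mult (@phi6 R) (toC f)) =
  (mean6 (fun x => f x * (3 / 2 * f x + 1 / 2 * f (x + 3) - 2 * mean6 f)))%:C.
Proof.
have meanC (h : 'Z_6 -> R) : mean6 (toC h) = (mean6 h)%:C.
  by rewrite /mean6 rmorphM fmorphV rmorph_nat rmorph_sum.
rewrite /inner -meanC; congr (_ * _); apply: eq_bigr => x _.
rewrite fourier_mult_phi6 meanC /toC.
rewrite [RHS]rmorphM; congr (_ * _).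
rewrite (_ : _ - _ = (3 / 2 * f x + 1 / 2 * f (x + 3) - 2 * mean6 f)%:C).
  exact: conjc_real.
by rewrite !(rmorphB, rmorphD, rmorphM, fmorphV, rmorph_nat) rmorph1.
Qed.
End Multiplier.

(** * From functions on the cyclic group to six numbers *)

Lemma mean6_pairs {R : realType} (h : 'Z_6 -> R) : mean6 h =
  (h 0 + h 3 + h 1 + h (1 + 3) + h 2 + h (2 + 3)) / 6.
Proof.
have -> : mean6 h = 6^-1 * \sum_(0 <= i < 6) h i%:R.
  by rewrite big_mkord; congr (_ * _); apply: eq_bigr => i _; rewrite natr_Zp.
rewrite -!natrD unlock /=.
by rewrite addr0 mulrC; congr (_ / _); ring.
Qed.

(* By [ln0], [ln 0 = 0], hence the summand at a zero of [f] is [0].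
   In [R[i]], [x <= y] means that [y - x] is a nonnegative real. *)
Theorem theorem3p2 (R : realType) (f : 'Z_6 -> R) (f_ge0 : forall x, 0 <= f x) :
  (mean6 (fun x => f x ^+ 2 * ln (f x ^+ 2))
     - norm2_sq f * ln (norm2_sq f))%:C
  <= 2 * inner (toC f) (fourier_mult (@phi6 R) (toC f)).
Proof.
have two : (2 : R[i]) = (2 : R)%:C by rewrite rmorph_nat.
rewrite inner_fourier_mult_phi6 two -rmorphM lecR.
have s33 : 3 + 3 = 0 :> 'Z_6 by rewrite -natrD pchar_Zp.
have s13 : 1 + 3 + 3 = 1 :> 'Z_6 by rewrite -addrA s33 addr0.
have s23 : 2 + 3 + 3 = 2 :> 'Z_6 by rewrite -addrA s33 addr0.
have := six_sqln_le _ _ _ _ _ _ (norm2_sq f) (f_ge0 0) (f_ge0 3) (f_ge0 1)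
  (f_ge0 (1 + 3)) (f_ge0 2) (f_ge0 (2 + 3)).
rewrite {1}/norm2_sq mean6_pairs !real_normK ?num_real // => /(_ erefl).
rewrite !mean6_pairs add0r s33 s13 s23 -!/(sqln _).
move: (f 0) (f 3) (f 1) (f (1 + 3)) (f 2) (f (2 + 3)) => a1 b1 a2 b2 a3 b3.
have shift (A B C D : R) : C = A -> D = B -> A <= B -> C <= D by move=> -> ->.
by apply: shift; last field.
Qed.
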